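(* Let $\theta(t)=(\theta_1(t),\dots,\theta_N(t))$, $t\ge 0$, be a solution of the system $$\gamma \ddot{\theta}_i(t) + \dot{\theta}_i(t) = \frac{\Omega_i}{d_i} + \frac{K}{N} \sum_{k=1}^N \frac{\psi_{ik}}{d_i} \sin (\theta_k(t) - \theta_i(t) + \alpha_{ik}),\quad t\ge 0,\ i=1,\dots,N,$$ where the network satisfies $\mathcal{C}>0$. Suppose that there exist a constant $\beta\in(0,\pi)$ and a constant $D^\infty$ with $0<D^\infty<\min\{\beta,\frac{\pi}{2}\}$ such that $$2\gamma (D_\Omega+ 2K \psi_u \sin \bar{\alpha}) + (1 + 4\gamma K \psi_u ) D_\theta(0) + 3\gamma D_\omega(0) < \beta < \pi,$$ $$D^\infty + \bar{\alpha} < \frac{\pi}{2},$$ $$\gamma K < \min\left\{\frac{\mathcal{C}\cos \bar{\alpha} \sin \beta}{32N\psi_u^2 \beta},\ \frac{N \beta}{\mathcal{C} \cos \bar{\alpha} \sin \beta},\ \frac{\mathcal{C}\cos (D^\infty + \bar{\alpha})}{32N \psi^2_u},\ \frac{2N }{\mathcal{C}\cos (D^\infty + \bar{\alpha})}\right\},$$ $$K > \max\left\{ \frac{8N\beta\left(D_\Omega + 2K \psi_u\sin\bar{\alpha} \right)}{D^\infty \mathcal{C} \cos \bar{\alpha} \sin \beta},\ \frac{8N\mu}{\mathcal{C} \cos (D^\infty + \bar{\alpha})}\right\},$$ where $$\mu := \frac{64N^2\psi^2_u\beta^2(D_\Omega + 2K \psi_u \sin \bar{\alpha}) (D^\infty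 + \sin \bar{\alpha})}{\mathcal{C}^2 \cos^2 \bar{\alpha} \sin^2 \beta}.$$ Then there exist positive constants $C,\Lambda$, depending on the initial data and the system parameters, such that $$D_\omega(t)\le C e^{-\Lambda t},\quad t\ge 0.$$
   Context: Setting (second-order Kuramoto model with homogeneous dampings and frustration). $N\ge 2$ is an integer; $d_i>0$ are damping coefficients, $m_i>0$ are inertia strengths with $m_i/d_i=\gamma$ for all $i$ (so $\gamma>0$); $\Omega_i\in\mathbb{R}$ are natural frequencies; $K>0$ is the coupling strength; $\psi_{ij}\ge 0$ are communication weights (not necessarily symmetric); $\alpha_{ij}\in[0,\frac{\pi}{2})$ are frustrations with $\alpha_{ii}=0$ for all $i$. Initial data $\theta_i(0)=\theta_{i0}$, $\dot\theta_i(0)=\omega_{i0}$ are given real numbers. Notation: $\omega_i=\dot\theta_i$; $D_\theta(t)=\max_i\theta_i(t)-\min_i\theta_i(t)$, $D_\omega(t)=\max_i\omega_i(t)-\min_i\omega_i(t)$; $D_\Omega=\max_i\frac{\Omega_i}{d_i}-\min_i\frac{\Omega_i}{d_i}$; $\bar\alpha=\max_{i,j}\alpha_{ij}$; $\psi_u=\max_{i\ne j}\frac{\psi_{ij}}{d_i}$; $$\mathcal{C}= \min_{1 \le i\ne j \le N} \left\{ \frac{\psi_{ij}}{d_i} + \frac{\psi_{ji}}{d_j} +\sum_{k \ne i,j} \min \left\{\frac{\psi_{ik}}{d_i}, \frac{\psi_{jk}}{d_j}\right\} \right\}.$$ *)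

(* Defs.v *)
From HB Require Import structures.
From mathcomp Require Import all_boot all_order all_algebra.
From mathcomp Require Import all_classical all_reals all_analysis.

Set Implicit Arguments.
Unset Strict Implicit.
Unset Printing Implicit Defensive.

Import Order.TTheory GRing.Theory Num.Theory.
Import numFieldNormedType.Exports.

Local Open Scope classical_set_scope.
Local Open Scope ring_scope.

(** The junk value 0 is only taken when no index satisfies [P]. *)
Definition fmax (R : realType) (I : finType) (P : pred I) (F : I -> R) : R :=
  if [pick i | P i] is Some i0 then F [arg max_(i > i0 | P i) F i]%O else 0.

Definition fmin (R : realType) (I : finType) (P : pred I) (F : I -> R) : R :=
  if [pick i | P i] is Some i0 then F [arg min_(i < i0 | P i) F i]%O else 0.

Lemma fmaxP (R : realType) (I : finType) (P : pred I) (F : I -> R) (i0 : I) :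
  P i0 ->
  (exists2 i, P i & fmax P F = F i) /\ (forall j, P j -> F j <= fmax P F).
Proof.
move=> Pi0; rewrite /fmax; case: pickP => [i Pi|/(_ i0)]; last by rewrite Pi0.
by case: arg_maxP => // k Pk Hk; split=> //; exists k.
Qed.

Lemma fminP (R : realType) (I : finType) (P : pred I) (F : I -> R) (i0 : I) :
  P i0 ->
  (exists2 i, P i & fmin P F = F i) /\ (forall j, P j -> fmin P F <= F j).
Proof.
move=> Pi0; rewrite /fmin; case: pickP => [i Pi|/(_ i0)]; last by rewrite Pi0.
by case: arg_minP => // k Pk Hk; split=> //; exists k.
Qed.

(** [D_theta t] is [spread (theta^~ t)], and similarly for [D_omega]. *)
Definition spread (R : realType) (N : nat) (x : 'I_N -> R) : R :=
  fmax predT x - fmin predT x.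

Definition DOmega (R : realType) (N : nat) (d Omega : 'I_N -> R) : R :=
  spread (fun i => Omega i / d i).

Definition alpha_bar (R : realType) (N : nat) (alpha : 'I_N -> 'I_N -> R) : R :=
  fmax predT (fun p : 'I_N * 'I_N => alpha p.1 p.2).

Definition psi_u (R : realType) (N : nat) (d : 'I_N -> R)
    (psi : 'I_N -> 'I_N -> R) : R :=
  fmax (fun p : 'I_N * 'I_N => p.1 != p.2) (fun p => psi p.1 p.2 / d p.1).

(** The network connectivity constant [\mathcal C]. *)
Definition connectivity (R : realType) (N : nat) (d : 'I_N -> R)
    (psi : 'I_N -> 'I_N -> R) : R :=
  fmin (fun p : 'I_N * 'I_N => p.1 != p.2)
    (fun p => let: (i, j) := p in
       psi i j / d i + psi j i / d j
       + \sum_(k < N | (k != i) && (k != j))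
           Num.min (psi i k / d i) (psi j k / d j)).

(** Differentiability at [t] relative to the time half-line [0, +oo[: the
    ordinary two-sided derivative when [t > 0], the right derivative when
    [t = 0].  The library's [is_derive] is two-sided and would constrain the
    values at negative times. *)
Definition has_time_derivative (R : realType) (f : R -> R) (t l : R) : Prop :=
  (fun s => (f s - f t) / (s - t)) @ within [set s | 0 <= s] t^' --> l.

(** [omega] is the velocity of [theta] and [a] the acceleration. *)
Definition kuramoto_solution (R : realType) (N : nat) (d Omega : 'I_N -> R)
    (gamma K : R) (psi alpha : 'I_N -> 'I_N -> R)
    (theta omega : 'I_N -> R -> R) : Prop :=
  forall (i : 'I_N) (t : R), 0 <= t ->
    has_time_derivative (theta i) t (omega i t) /\
    exists2 a : R, has_time_derivative (omega i) t a &
      gamma * a + omega i t =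
        Omega i / d i
        + K / N%:R * \sum_(k < N) psi i k / d i
                       * sin (theta k t - theta i t + alpha i k).

Definition mu (R : realType) (N : nat) (d Omega : 'I_N -> R) (K : R)
    (psi alpha : 'I_N -> 'I_N -> R) (beta Dinf : R) : R :=
  64 * N%:R ^+ 2 * psi_u d psi ^+ 2 * beta ^+ 2
    * (DOmega d Omega + 2 * K * psi_u d psi * sin (alpha_bar alpha))
    * (Dinf + sin (alpha_bar alpha))
  / (connectivity d psi ^+ 2 * cos (alpha_bar alpha) ^+ 2 * sin beta ^+ 2).

(* Main.v *)
Require Import Defs.
From HB Require Import structures.
From mathcomp Require Import all_boot all_order all_algebra.
From mathcomp Require Import all_classical all_reals all_analysis.
From mathcomp Require Import ring lra.

(** With u = theta + gamma omega the system reads u' = b - Lap(t) theta, where b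
    has spread at most DOmega + 2 K psi_u sin(alpha_bar) and Lap(t) is a weighted
    Laplacian with weights proportional to
    sinc (theta_k - theta_i) cos (alpha_ik).  As long as D_theta <= beta, its
    ergodicity coefficient is at least
    kappa = (K / N) C cos(alpha_bar) sin(beta) / beta.
    Writing P, Q for the spreads of u and of gamma omega and L = K psi_u, one gets
    P' <= A - kappa P + 2 L Q and Q' <= A + 2 L (P + Q) - Q / gamma, so that
    P + 4 gamma L Q decays at rate kappa / 2 up to a term of order A because
    32 gamma L^2 < kappa.  Since D_theta <= P + Q, explicit barriers for
    P + 4 gamma L Q and Q keep D_theta below beta forever and below Dinf from an
    explicit time T on.  After T, the differentiated system has the same form
    with theta, omega replaced by omega, omega', with weights proportional to
    cos (theta_k - theta_i + alpha_ik) and with b = 0, so the same functional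
    decays exponentially and dominates D_omega. *)

Set Implicit Arguments.
Unset Strict Implicit.
Unset Printing Implicit Defensive.

Import Order.TTheory GRing.Theory Num.Theory.
Import numFieldNormedType.Exports.

Local Open Scope classical_set_scope.
Local Open Scope ring_scope.

(** * Weighted Laplacians *)

(** Minus a weighted graph Laplacian applied to [x]. The term [k = i] vanishes, so weight hypotheses
    are stated for distinct indices. *)
Definition coupling (R : pzRingType) (N : nat) (w : 'I_N -> 'I_N -> R) (x : 'I_N -> R)
    (i : 'I_N) : R :=
  \sum_(k < N) w i k * (x k - x i).

Section Coupling.
Variables (R : realFieldType) (N : nat).
Implicit Types (w a : 'I_N -> 'I_N -> R) (x y b : 'I_N -> R).

(** The pairwise quantity minimized in [connectivity], for arbitrary weights: direct pull between
    [i] and [j] plus their common pull from third nodes, as in Dobrushin's coefficient. *)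
Definition ergodicity a (i j : 'I_N) : R :=
  a i j + a j i + \sum_(k < N | (k != i) && (k != j)) Num.min (a i k) (a j k).

Lemma ergodicity_le_scaled a w (r : R) i j : 0 <= r -> i != j ->
  (forall k l, k != l -> r * a k l <= w k l) ->
  r * ergodicity a i j <= ergodicity w i j.
Proof.
move=> r0 ij aw; rewrite /ergodicity 2!mulrDr mulr_sumr.
apply: lerD; first by apply: lerD; apply: aw; rewrite // eq_sym.
apply: ler_sum => k /andP[ki kj]; rewrite le_min minr_pMr// ge_min aw 1?eq_sym//=.
by rewrite ge_min orbC aw 1?eq_sym.
Qed.

(** Two direct weights and [N - 2] minima make [N] terms. This yields [connectivity <= N psi_u],
    hence [kappa <= L]. *)
Lemma ergodicity_le a (M : R) i j : i != j -> (forall k l, k != l -> a k l <= M) ->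
  ergodicity a i j <= N%:R * M.
Proof.
move=> ij aM; have -> : N%:R * M = \sum_(k < N) M.
  by rewrite sumr_const card_ord mulr_natl.
rewrite (bigD1 i)//= (bigD1 j) 1?eq_sym//= addrA /ergodicity.
apply: lerD; first by apply: lerD; apply: aM; rewrite // eq_sym.
by apply: ler_sum => k /andP[ki kj]; rewrite ge_min aM// eq_sym.
Qed.

Lemma couplingB w x y i :
  coupling w (fun k => x k - y k) i = coupling w x i - coupling w y i.
Proof. by rewrite /coupling -sumrB; apply: eq_bigr => k _; ring. Qed.

Lemma coupling_bound w x (L D : R) i : 0 <= L ->
  (forall k l, x k - x l <= D) ->
  (forall k l, k != l -> 0 <= w k l <= L / N%:R) ->
  `|coupling w x i| <= L * D.
Proof.
move=> L0 xD wL; have N0 : N%:R != 0 :> R.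
  by rewrite pnatr_eq0 -lt0n; apply: leq_ltn_trans (ltn_ord i).
have D0 : 0 <= D by apply: le_trans (xD i i); rewrite subrr.
apply: le_trans (ler_norm_sum _ _ _) _.
have -> : L * D = \sum_(k < N) L / N%:R * D.
  by rewrite sumr_const card_ord -mulr_natl; field.
apply: ler_sum => k _; have [->|ik] := eqVneq k i.
  by rewrite subrr mulr0 normr0 mulr_ge0// divr_ge0.
have /andP[w0 w1] : 0 <= w i k <= L / N%:R by apply: wL; rewrite eq_sym.
rewrite normrM (ger0_norm w0) ler_pM// ler_norml xD andbT.
by rewrite lerNl opprB xD.
Qed.

(* Between the two extremal oscillators every third one pulls them together
   with at least the smaller of its two weights. *)
Lemma coupling_extremal w x (kappa : R) i j :
  (forall k, x k <= x i) -> (forall k, x j <= x k) ->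
  (forall k l, k != l -> 0 <= w k l) ->
  (forall k l, k != l -> kappa <= ergodicity w k l) ->
  coupling w x i - coupling w x j <= - (kappa * (x i - x j)).
Proof.
move=> xi xj w0 kw; have [->|ij] := eqVneq i j; first by rewrite !subrr mulr0 oppr0.
have ji : j != i by rewrite eq_sym.
apply: (@le_trans _ _ (- (ergodicity w i j * (x i - x j)))); last first.
  by rewrite lerN2 ler_wpM2r ?kw// subr_ge0.
rewrite /coupling (bigD1 i)//= (bigD1 j)//= [X in _ - X](bigD1 i)//=.
rewrite [X in _ - (_ + X)](bigD1 j)//=.
rewrite !subrr !mulr0.
rewrite !add0r; set S1 := (X in w i j * _ + X); set S2 := (X in w j i * _ + X).
suff: S1 - S2 <= - ((\sum_(k < N | (k != i) && (k != j)) Num.min (w i k) (w j k))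
                   * (x i - x j)).
  rewrite /ergodicity; set S := \sum_(_ < N | _) _; lra.
rewrite /S1 /S2 -sumrB -mulNr -sumrN mulr_suml; apply: ler_sum => k /andP[ki kj].
have := xi k; have := xj k; have := w0 i k; have := w0 j k.
rewrite !(eq_sym _ k) => /(_ kj) wj /(_ ki) wi x1 x2.
set m := Num.min _ _.
have mi : m <= w i k by rewrite ge_min lexx.
have mj : m <= w j k by rewrite ge_min lexx orbT.
have := ler_wpM2r (_ : 0 <= x i - x k) mi; rewrite subr_ge0 => /(_ x2).
have := ler_wpM2r (_ : 0 <= x k - x j) mj; rewrite subr_ge0 => /(_ x1).
lra.
Qed.

(** * Differential inequalities at a frozen time *)

Section SecondOrder.
Variables (w : 'I_N -> 'I_N -> R) (b x y : 'I_N -> R) (gamma L kappa A : R).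
Hypotheses (gamma_gt0 : 0 < gamma) (L_gt0 : 0 < L).
Hypotheses (kappa_leL : kappa <= L) (L_kappa : 32 * gamma * L ^+ 2 < kappa).
Hypotheses (A_ge0 : 0 <= A) (b_spread : forall i j, b i - b j <= A).
Hypothesis (w_bound : forall i j, i != j -> 0 <= w i j <= L / N%:R).

(** For x' = y and gamma y' = force - y one has u' = force, which removes the damping term from the
    equation for [u]. *)
Let u i := x i + gamma * y i.
Let force i := b i + coupling w x i.

(** Divide 32 gamma L^2 < kappa <= L by L. This dimensionless smallness absorbs the cross terms
    below. *)
Lemma gammaL_lt : 32 * (gamma * L) < 1.
Proof.
rewrite -(ltr_pM2r L_gt0) mul1r; apply: lt_le_trans kappa_leL.
by apply: le_lt_trans L_kappa; rewrite expr2 !mulrA.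
Qed.

Lemma force_spread D i j :
  (forall k l, x k - x l <= D) -> force i - force j <= A + 2 * L * D.
Proof.
move=> xD; have := b_spread i j; have L0 := ltW L_gt0.
have := coupling_bound i L0 xD w_bound; have := coupling_bound j L0 xD w_bound.
rewrite /force !ler_norml => /andP[? ?] /andP[? ?] ?; lra.
Qed.

Lemma spread_position P Q :
  (forall i j, u i - u j <= P) -> (forall i j, gamma * (y i - y j) <= Q) ->
  forall i j, x i - x j <= P + Q.
Proof. by move=> uP yQ i j; have := uP i j; have := yQ j i; rewrite /u; lra. Qed.

Hypothesis w_erg : forall i j, i != j -> kappa <= ergodicity w i j.

(** The left side is the derivative of the functional at a maximizing quadruple. The functional
    splits into a part in [(i, j)] and a part in [(k, l)], so a joint maximizer realizes both the
    spread [P] of [u] and the spread [Q] of [gamma y]. *)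
Lemma lyapunov_decay i j k l :
  (forall i' j' k' l', u i' - u j' + 4 * gamma * L * (gamma * (y k' - y l')) <=
                       u i - u j + 4 * gamma * L * (gamma * (y k - y l))) ->
  force i - force j + 4 * gamma * L * (force k - y k - (force l - y l)) <=
  9 / 8 * A - kappa / 2 * (u i - u j + 4 * gamma * L * (gamma * (y k - y l))).
Proof.
move=> fmax; have gL0 : 0 < 4 * gamma * L by rewrite !mulr_gt0.
have gL := gammaL_lt.
set P := u i - u j in fmax *; set Q := gamma * (y k - y l) in fmax *.
have uP i' j' : u i' - u j' <= P by move: (fmax i' j' k l); rewrite lerD2r.
have yQ k' l' : gamma * (y k' - y l') <= Q.
  by move: (fmax i j k' l'); rewrite lerD2l ler_pM2l.
have P0 : 0 <= P by have := uP i i; rewrite subrr.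
have Q0 : 0 <= Q by have := yQ i i; rewrite subrr mulr0.
have Fkl := force_spread k l (spread_position uP yQ).
(* The indices [i], [j] are extremal for [u], not for [x]: contraction is applied to [u], and the
   remainder [gamma y] costs at most 2 L Q. *)
have Fij : force i - force j <= A - kappa * P + 2 * L * Q.
  have xE m : coupling w x m = coupling w u m - coupling w (fun n => gamma * y n) m.
    by rewrite -couplingB; apply: eq_bigr => n _; rewrite /u !addrK.
  have Hu : coupling w u i - coupling w u j <= - (kappa * P).
    apply: coupling_extremal => //.
    - by move=> m; have := uP m j; rewrite /P lerD2r.
    - by move=> m; have := uP i m; rewrite /P lerD2l lerN2.
    - by move=> m n /w_bound/andP[].
  have yQ' k' l' : gamma * y k' - gamma * y l' <= Q by rewrite -mulrBr.
  have := coupling_bound i (ltW L_gt0) yQ' w_bound.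
  have := coupling_bound j (ltW L_gt0) yQ' w_bound.
  rewrite !ler_norml => /andP[? ?] /andP[? ?].
  by have := b_spread i j; rewrite /force !xE; lra.
have -> : force k - y k - (force l - y l) = force k - force l - Q / gamma.
  by rewrite /Q mulrC mulKf ?gt_eqF//; ring.
apply: (@le_trans _ _ (A - kappa * P + 2 * L * Q +
    4 * gamma * L * (A + 2 * L * (P + Q) - Q / gamma))).
  by apply: lerD => //; rewrite ler_pM2l// lerD2r.
have -> : 4 * gamma * L * (A + 2 * L * (P + Q) - Q / gamma) =
    4 * (gamma * L) * A + 8 * gamma * L ^+ 2 * (P + Q) - 4 * L * Q.
  by field; rewrite gt_eqF.
(* Coefficients: A gets 1 + 1/8. The term 8 gamma L^2 P costs a quarter of kappa P, leaving 3/4 >=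
   1/2. For Q, 2 L + L/4 - 4 L = -7 L/4, while only 2 gamma kappa L <= L/16 of decay is required. *)
have H1 : 4 * (gamma * L) * A <= 1 / 8 * A by rewrite ler_wpM2r//; lra.
have H2 : 32 * gamma * L ^+ 2 * P <= kappa * P by rewrite ler_wpM2r// ltW.
have H3 : 32 * gamma * L ^+ 2 * Q <= L * Q.
  by rewrite ler_wpM2r// (le_trans (ltW L_kappa)).
have H4 : kappa * (gamma * L * Q) <= 1 / 32 * L * Q.
  apply: (@le_trans _ _ (L * (gamma * L * Q))).
    have := mulr_ge0 (mulr_ge0 (ltW gamma_gt0) (ltW L_gt0)) Q0.
    by move=> /ler_wpM2r; apply.
  by have := ler_wpM2r (mulr_ge0 (ltW L_gt0) Q0) (ltW gL); lra.
have H5 : 0 <= L * Q by rewrite mulr_ge0// ltW.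
have H6 : 0 <= kappa * P.
  by rewrite mulr_ge0// ltW// (le_lt_trans _ L_kappa)// !mulr_ge0// ?sqr_ge0// ltW.
lra.
Qed.

End SecondOrder.
End Coupling.

(** * First touching times *)

Lemma time_derivative_dist (R : realType) (f : R -> R) (t l : R) :
  has_time_derivative f t l -> forall e, 0 < e -> exists2 r, 0 < r &
    forall s, 0 <= s -> s != t -> `|t - s| < r ->
      `|l - (f s - f t) / (s - t)| < e.
Proof.
move=> /cvgrPdist_lt fl e e0; have /nbhs_ballP[r /= r0 Hr] := fl e e0.
by exists r => // s s0 st tsr; apply: Hr.
Qed.

Lemma time_derivative_is_derive (R : realType) (f : R -> R) (t l : R) :
  0 < t -> has_time_derivative f t l -> is_derive t 1 f l.
Proof.
move=> t0 fl; have H : h^-1 *: ((f \o shift t) (h *: 1) - f t) @[h --> 0^'] --> l.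
  apply/cvgrPdist_lt => e e0.
  have [r r0 Hr] := time_derivative_dist fl e0.
  (* The bound by [t] keeps [h + t] in the half-line where the one-sided notion gives
     information. *)
  apply/nbhs_ballP; exists (Num.min r t) => /=; first by rewrite lt_min r0.
  move=> h; rewrite /ball/= sub0r normrN lt_min => /andP[hr ht] h0.
  have := Hr (h + t); rewrite opprD addrCA subrr addr0 normrN addrK mulrC.
  rewrite -subr_eq0 addrK /shift [_ *: 1]mulr1; apply => //.
  by move: ht; rewrite ltr_norml => /andP[? _]; rewrite -lerBlDr sub0r ltW.
split; first by apply/cvg_ex; exists l.
exact: cvg_lim H.
Qed.

Lemma time_derivative_right_continuous (R : realType) (f : R -> R) (l : R) :
  has_time_derivative f 0 l -> f s @[s --> 0^'+] --> f 0.
Proof.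
move=> fl; apply/cvgrPdist_lt => e e0.
have [r r0 Hr] := time_derivative_dist fl ltr01.
have l1 : 0 < `|l| + 1 by rewrite ltr_wpDl.
(* Within distance [r] the slope is within 1 of [l], so f varies by at most (|l| + 1) s. *)
apply/nbhs_ballP; exists (Num.min r (e / (`|l| + 1))) => /=.
  by rewrite lt_min r0 divr_gt0.
move=> s; rewrite /ball/= lt_min => /andP[sr se] s0.
have := Hr s (ltW s0) (lt0r_neq0 s0) sr; rewrite subr0 => H.
move: se; rewrite sub0r normrN (gtr0_norm s0) ltr_pdivlMr//.
apply: le_lt_trans.
have -> : f 0 - f s = s * ((l - (f s - f 0) / s) - l) by field; rewrite gt_eqF.
rewrite normrM (gtr0_norm s0) ler_pM2l//.
by apply: le_trans (ler_normB _ _) _; rewrite addrC lerD2l ltW.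
Qed.

(** Let T be the infimum of the times at which some [h s] is nonnegative. At T all [h r] are at most
    0 and some [h s] vanishes after having been negative, so its left difference quotients are
    nonnegative, against [dh s T < 0]. At [t0] only right continuity is asked, which suits the time
    half-line. *)
Lemma first_touch (R : realType) (S : finType) (t0 : R) (h dh : S -> R -> R) :
  (forall s, h s t @[t --> t0^'+] --> h s t0) ->
  (forall s t, t0 < t -> is_derive t 1 (h s) (dh s t)) ->
  (forall s, h s t0 < 0) ->
  (forall t s, t0 < t -> (forall r, h r t <= 0) -> h s t = 0 -> dh s t < 0) ->
  forall t s, t0 <= t -> h s t < 0.
Proof.
move=> h_right h_der h_t0 h_touch t1 s1 t01; rewrite ltNge; apply/negP => h1.
pose E := [set t | t0 <= t /\ exists s, 0 <= h s t].
have Et1 : E t1 by split => //; exists s1.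
have E_lb : lbound E t0 by move=> t [].
have E_inf : has_inf E by split; [exists t1 | exists t0].
set T := inf E; have t0T : t0 <= T by apply: lb_le_inf => //; exists t1.
have before s t : t0 <= t -> t < T -> h s t < 0.
  move=> t0t tT; rewrite ltNge; apply/negP => hs.
  move: tT; rewrite ltNge => /negP; apply.
  by apply: ge_inf; [exists t0|split=> //; exists s].
have right_cont s : h s t @[t --> T^'+] --> h s T.
  move: t0T; rewrite le_eqVlt => /predU1P[<-//|t0T].
  have [dhs _] := h_der s T t0T.
  exact/cvg_at_right_filter/differentiable_continuous/derivable1_diffP.
(* The infimum is attained: otherwise, [S] being finite, all [h s] stay negative on a common right
   neighbourhood of T. *)
have [s hs] : exists s, 0 <= h s T.
  apply: contrapT => /forallNP H.
  have : \forall t \near T^'+, forall s, h s t < 0.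
    apply: filter_forall => s.
    by apply: (cvgr_lt (h s T)) => //; rewrite ltNge; apply/negP/H.
  move=> /nbhs_ballP[r /= r0 Hr].
  have [t Et tT] := inf_adherent r0 E_inf.
  have Tt : T <= t by apply: ge_inf => //; exists t0.
  have [t0t [s hs]] := Et.
  move: Tt; rewrite le_eqVlt => /predU1P[Tt|Tt].
    by apply: (H s); rewrite Tt.
  have Hb : ball T r t by rewrite /ball/= distrC gtr0_norm ?subr_gt0// ltrBlDl.
  by have := Hr t Hb Tt s; rewrite ltNge hs.
have t0T' : t0 < T.
  by rewrite lt_neqAle t0T andbT; apply: contraTneq hs => <-; rewrite -ltNge.
have le0 r : h r T <= 0.
  have [dhr _] := h_der r T t0T'.
  have : h r t @[t --> T^'-] --> h r T.
    exact/cvg_at_left_filter/differentiable_continuous/derivable1_diffP.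
  move=> /cvgr_to_le; apply; near=> t; apply/ltW/before; near: t.
    by apply: nbhs_left_ge.
  exact: nbhs_left_lt.
have hsT : h s T = 0 by apply/eqP; rewrite eq_le le0.
have dneg := h_touch T s t0T' le0 hsT.
have [/= dhs dhsE] := h_der s T t0T'.
have : u^-1 *: ((h s \o shift T) (u *: 1) - h s T) @[u --> 0^'] --> dh s T.
  by rewrite -dhsE.
move=> /cvg_dnbhs_at_left /cvgr_lt /(_ _ dneg) Hu.
near (0 : R)^'- => u.
have u0 : u < 0 by near: u; exact: nbhs_left_lt.
have : u^-1 *: ((h s \o shift T) (u *: 1) - h s T) < 0 by near: u.
rewrite hsT subr0 /= /shift [_ *: 1]mulr1 ltNge => /negP; apply.
rewrite nmulr_rge0 ?invr_lt0//; apply/ltW/before; last by rewrite gtrDr.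
near: u.
have : 0 > t0 - T by rewrite subr_lt0.
by move=> /nbhs_left_gt; apply: filterS => u; rewrite ltrBlDr => /ltW.
Unshelve. all: by end_near.
Qed.

(** * Second-order consensus systems *)

Lemma is_derive_exp_barrier (R : realType) (c m r t : R) :
  is_derive t 1 (fun s => c + m * expR (r * s)) (m * (r * expR (r * t))).
Proof.
suff : is_derive t 1 (cst c + m \*: (expR \o (r \*: @id R)))
  (m * (r * expR (r * t))) by [].
by apply: is_derive_eq; rewrite /GRing.scale /=; ring.
Qed.

Lemma is_derive_right_continuous (R : realType) (f : R -> R) (t l : R) :
  is_derive t 1 f l -> f s @[s --> t^'+] --> f t.
Proof.
by move=> [df _]; exact/cvg_at_right_filter/differentiable_continuous/derivable1_diffP.
Qed.

(* With weight 4 gamma L on the velocity spread Q, the derivative contains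
   - (kappa - 8 gamma L^2) P - (2 L - 8 gamma L^2) Q, and both coefficients are
   under control as soon as 32 gamma L^2 < kappa <= L. *)
Definition lyapunov (R : realType) (N : nat) (x y : 'I_N -> R -> R) (gamma L : R)
    (p : 'I_N * 'I_N * 'I_N * 'I_N) (t : R) : R :=
  x p.1.1.1 t + gamma * y p.1.1.1 t - (x p.1.1.2 t + gamma * y p.1.1.2 t)
  + 4 * gamma * L * (gamma * (y p.1.2 t - y p.2 t)).

Section SecondOrderSystem.
Variables (R : realType) (N : nat) (x y : 'I_N -> R -> R).
Variables (w : R -> 'I_N -> 'I_N -> R) (b : R -> 'I_N -> R).
Variables (gamma L kappa t0 : R).
Hypotheses (gamma_gt0 : 0 < gamma) (L_gt0 : 0 < L).
Hypotheses (kappa_leL : kappa <= L) (L_kappa : 32 * gamma * L ^+ 2 < kappa).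

Let V := lyapunov x y gamma L.
Let force t i := b t i + coupling (w t) (x^~ t) i.
Let dV (p : 'I_N * 'I_N * 'I_N * 'I_N) t :=
  force t p.1.1.1 - force t p.1.1.2
  + 4 * gamma * L * (force t p.1.2 - y p.1.2 t - (force t p.2 - y p.2 t)).

Hypotheses (x_der : forall i t, t0 < t -> is_derive t 1 (x i) (y i t)).
Hypotheses (y_der : forall i t, t0 < t ->
  is_derive t 1 (y i) ((force t i - y i t) / gamma)).
Hypotheses (x_right : forall i, x i s @[s --> t0^'+] --> x i t0).
Hypotheses (y_right : forall i, y i s @[s --> t0^'+] --> y i t0).

Lemma lyapunov_der p t : t0 < t -> is_derive t 1 (V p) (dV p t).
Proof.
move=> t0t; have dx m := x_der m t0t; have dy m := y_der m t0t.
suff : is_derive t 1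
  (x p.1.1.1 + gamma \*: y p.1.1.1 - (x p.1.1.2 + gamma \*: y p.1.1.2)
   + (4 * gamma * L) \*: (gamma \*: (y p.1.2 - y p.2))) (dV p t) by [].
apply: is_derive_eq; rewrite /dV /GRing.scale /=.
by field; rewrite gt_eqF.
Qed.

Lemma lyapunov_right p : V p s @[s --> t0^'+] --> V p t0.
Proof.
rewrite /V /lyapunov; apply: cvgD.
  by apply: cvgB; (apply: cvgD; [exact: x_right|apply: cvgMr; exact: y_right]).
by apply: cvgMr; apply: cvgMr; apply: cvgB; exact: y_right.
Qed.

Let kappa_gt0 : 0 < kappa.
Proof. by apply: le_lt_trans L_kappa; rewrite !mulr_ge0 ?sqr_ge0// ltW. Qed.

Lemma lyapunov_max_decay A p t : 0 <= A ->
  (forall i j, b t i - b t j <= A) ->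
  (forall i j, i != j -> 0 <= w t i j <= L / N%:R) ->
  (forall i j, i != j -> kappa <= ergodicity (w t) i j) ->
  (forall q, V q t <= V p t) ->
  dV p t <= 9 / 8 * A - kappa / 2 * V p t.
Proof.
move=> A0 bA wL wk Vmax.
apply: (@lyapunov_decay _ _ (w t) (b t) (x^~ t) (y^~ t)) => //.
by move=> i j k l; exact: (Vmax (i, j, k, l)).
Qed.

(** With zero forcing the maximal V decays at rate kappa / 2. The slower barrier rate kappa / 4
    supplies the strict inequality needed by [first_touch]. *)
Lemma homogeneous_decay (B0 : R) :
  (forall t, t0 < t -> forall i j, b t i - b t j <= 0) ->
  (forall t, t0 < t -> forall i j, i != j -> 0 <= w t i j <= L / N%:R) ->
  (forall t, t0 < t -> forall i j, i != j -> kappa <= ergodicity (w t) i j) ->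
  0 < B0 -> (forall p, V p t0 < B0 * expR (- (kappa / 4) * t0)) ->
  forall p t, t0 <= t -> V p t < B0 * expR (- (kappa / 4) * t).
Proof.
move=> bA wL wk B00 init p t t0t.
pose g (s : R) : R := 0 + B0 * expR (- (kappa / 4) * s).
suff : V p t - g t < 0 by rewrite /g add0r subr_lt0.
pose dg (s : R) : R := B0 * (- (kappa / 4) * expR (- (kappa / 4) * s)).
have g_der (s : R) : is_derive s 1 g (dg s) by exact: is_derive_exp_barrier.
apply: (@first_touch R ('I_N * 'I_N * 'I_N * 'I_N)%type t0
  (fun p => V p - g) (fun p s => dV p s - dg s)) => //.
- move=> q; apply: cvgB; first exact: lyapunov_right.
  exact: is_derive_right_continuous (g_der t0).
- move=> q s t0s; apply: is_deriveB; exact: lyapunov_der.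
- by move=> q; suff : V q t0 - g t0 < 0 by []; rewrite /g add0r subr_lt0.
- move=> {p t t0t} s p t0s h0 hs.
  have Vs : V p s = g s by apply/eqP; rewrite -subr_eq0; apply/eqP.
  have := @lyapunov_max_decay 0 p s (lexx 0) (bA s t0s) (wL s t0s) (wk s t0s).
  have Vmax q : V q s <= V p s by rewrite -subr_le0 Vs; exact: h0.
  move=> /(_ Vmax); rewrite Vs.
  have : 0 < kappa * (B0 * expR (- (kappa / 4) * s)) by rewrite !mulr_gt0 ?expR_gt0.
  rewrite /dg /g add0r; lra.
Qed.

(** * Explicit barriers and confinement of the phases *)

Section Confinement.
Variables (A D beta m q : R).
Hypotheses (A_ge0 : 0 <= A) (m_ge0 : 0 <= m) (q_ge0 : 0 <= q).
Hypothesis A_small : 8 * A < kappa * D.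

(** The inequality V' <= 9/8 A - kappa/2 V has equilibrium 9 A / (4 kappa), which is below 9 D / 32
    by [A_small]; the level D / 3 lies strictly above it. *)
Definition lyapunov_barrier (t : R) : R := D / 3 + m * expR (- (kappa / 2) * t).

(** Twice the quasi-static level gamma A + 2 gamma L W of Q' <= A + 2 L (W + Q) - Q / gamma, plus a
    transient for the initial velocity spread. The doubling absorbs 2 gamma L Q <= Q / 16 and the
    slope of the barrier. *)
Definition velocity_barrier (t : R) : R :=
  2 * gamma * A + 4 * gamma * L * lyapunov_barrier t + q * expR (- (kappa / 2) * t).

Let Wb := lyapunov_barrier.
Let Qb := velocity_barrier.

Lemma barriers_decrease s t : s <= t -> Wb t + Qb t <= Wb s + Qb s.
Proof.
move=> st; have : expR (- (kappa / 2) * t) <= expR (- (kappa / 2) * s).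
  by rewrite ler_expR ler_wnM2l// oppr_le0 divr_ge0// ltW.
rewrite -subr_ge0 => e0; have := mulr_ge0 m_ge0 e0; have := mulr_ge0 q_ge0 e0.
have /mulr_ge0 /(_ (mulr_ge0 m_ge0 e0)) : 0 <= gamma * L by rewrite mulr_ge0// ltW.
rewrite /Wb /Qb /velocity_barrier /lyapunov_barrier; lra.
Qed.

Hypothesis regime : forall t, t0 < t -> (forall i j, x i t - x j t <= beta) ->
  [/\ forall i j, b t i - b t j <= A,
      forall i j, i != j -> 0 <= w t i j <= L / N%:R &
      forall i j, i != j -> kappa <= ergodicity (w t) i j].
Hypothesis barrier_beta : Wb t0 + Qb t0 <= beta.

Lemma confinement :
  (forall p, V p t0 < Wb t0) ->
  (forall i j, gamma * (y i t0 - y j t0) < Qb t0) ->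
  forall t, t0 <= t -> (forall p, V p t < Wb t) /\
    (forall i j, gamma * (y i t - y j t) < Qb t).
Proof.
move=> V0 y0.
have gL := gammaL_lt L_gt0 kappa_leL L_kappa.
have gL0 : 0 < gamma * L by rewrite mulr_gt0.
have D0 : 0 < D.
  by rewrite -(pmulr_rgt0 _ kappa_gt0); apply: le_lt_trans A_small; rewrite mulr_ge0.
pose e (t : R) : R := expR (- (kappa / 2) * t).
pose de (t : R) : R := - (kappa / 2) * e t.
have W_der (t : R) : is_derive t 1 Wb (m * de t) by exact: is_derive_exp_barrier.
have QE : Qb = fun t : R => 2 * gamma * A + 4 * gamma * L * (D / 3)
                      + (4 * gamma * L * m + q) * e t.
  by apply/funext => t; rewrite /Qb /velocity_barrier /lyapunov_barrier /e; ring.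
have Q_der (t : R) : is_derive t 1 Qb ((4 * gamma * L * m + q) * de t).
  by rewrite QE; exact: is_derive_exp_barrier.
(* The two barriers are compared simultaneously: as long as neither has been
   crossed the phases stay within beta, so that [regime] applies. *)
pose h (s : ('I_N * 'I_N * 'I_N * 'I_N) + ('I_N * 'I_N)) : R -> R :=
  match s with
  | inl p => V p - Wb
  | inr (i, j) => gamma \*: (y i - y j) - Qb
  end.
pose dh (s : ('I_N * 'I_N * 'I_N * 'I_N) + ('I_N * 'I_N)) (t : R) : R :=
  match s with
  | inl p => dV p t - m * de t
  | inr (i, j) => force t i - y i t - (force t j - y j t)
                  - (4 * gamma * L * m + q) * de t
  end.
have h_neg : forall t s, t0 <= t -> h s t < 0.
  apply: (@first_touch R (('I_N * 'I_N * 'I_N * 'I_N) + ('I_N * 'I_N))%type t0 h dh).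
  - move=> [p|[i j]]; apply: cvgB.
    + exact: lyapunov_right.
    + exact: is_derive_right_continuous (W_der t0).
    + by apply: cvgMr; apply: cvgB; exact: y_right.
    + exact: is_derive_right_continuous (Q_der t0).
  - move=> [p|[i j]] t t0t.
      by apply: is_deriveB; exact: lyapunov_der.
    have dyi := y_der i t0t; have dyj := y_der j t0t; have dQ := Q_der t.
    apply: is_derive_eq; rewrite /dh /GRing.scale /=.
    by field; rewrite gt_eqF.
  - move=> [p|[i j]]; rewrite -subr_gt0 sub0r /h.
      suff : V p t0 - Wb t0 < 0 by rewrite oppr_gt0.
      by rewrite subr_lt0.
    suff : gamma * (y i t0 - y j t0) - Qb t0 < 0 by rewrite oppr_gt0.
    by rewrite subr_lt0.
  - move=> t s t0t hle hs.
    have Vle p : V p t <= Wb t by rewrite -subr_le0; exact: (hle (inl p)).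
    have yle i j : gamma * (y i t - y j t) <= Qb t.
      by rewrite -subr_le0; exact: (hle (inr (i, j))).
    have ule i j : x i t + gamma * y i t - (x j t + gamma * y j t) <= Wb t.
      by have := Vle (i, j, i, i); rewrite /V /lyapunov /= subrr !mulr0 addr0.
    have xle i j : x i t - x j t <= Wb t + Qb t.
      exact: (@spread_position _ _ (x^~ t) (y^~ t)).
    have xbeta i j : x i t - x j t <= beta.
      apply: le_trans (xle i j) (le_trans _ barrier_beta).
      by apply: barriers_decrease; exact: ltW.
    have [bA wL wk] := regime t0t xbeta.
    have e0 : 0 < e t by exact: expR_gt0.
    have WbE : Wb t = D / 3 + m * e t by [].
    have me0 : 0 <= m * e t by rewrite mulr_ge0// ltW.
    have qe0 : 0 <= q * e t by rewrite mulr_ge0// ltW.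
    case: s hs => [p|[i j]] hs.
      (* At contact the transients cancel, leaving 9/8 A - kappa D / 6, negative because 8 A < kappa
         D. *)
      have VE : V p t = Wb t by apply/eqP; rewrite -subr_eq0; apply/eqP.
      have Vmax r : V r t <= V p t by rewrite VE.
      have := lyapunov_max_decay A_ge0 bA wL wk Vmax; rewrite VE /dh /de WbE /=.
      have := mulr_ge0 (ltW kappa_gt0) me0.
      have := mulr_gt0 kappa_gt0 D0; have := A_small; have := A_ge0; lra.
    have yE : gamma * (y i t - y j t) = Qb t by apply/eqP; rewrite -subr_eq0; apply/eqP.
    have := @force_spread _ _ (w t) (b t) (x^~ t) L A L_gt0 bA wL _ i j xle.
    rewrite -/(force t i) -/(force t j) => F.
    rewrite /dh -(pmulr_rlt0 _ gamma_gt0) /de.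
    (* Multiplying by gamma clears the damping denominator; the barrier slope then carries the
       factor gamma kappa <= gamma L <= 1/32. *)
    have -> : gamma * (force t i - y i t - (force t j - y j t)
                       - (4 * gamma * L * m + q) * (- (kappa / 2) * e t)) =
        gamma * (force t i - force t j) - Qb t
        + (2 * (gamma * L) * (m * e t) + q * e t / 2) * (gamma * kappa).
      by rewrite -yE; field.
    have /(ler_wpM2l (ltW gamma_gt0)) := F.
    have gk : gamma * kappa <= 1 / 32.
      by have := ler_wpM2l (ltW gamma_gt0) kappa_leL; lra.
    have H1 : 0 <= 2 * (gamma * L) * (m * e t) + q * e t / 2.
      have := mulr_ge0 (ltW gL0) me0; lra.
    have H2 := ler_wpM2l H1 gk.
    have H3 : 0 < gamma * L * D by rewrite mulr_gt0.
    have H4 : 0 <= gamma * A by rewrite mulr_ge0// ltW.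
    have QbE : Qb t = 2 * gamma * A + 4 * gamma * L * Wb t + q * e t by [].
    have Wb0 : 0 < Wb t by rewrite WbE; lra.
    have H5 : 0 < gamma * L * Wb t by rewrite mulr_gt0.
    have Qb0 : 0 <= Qb t by rewrite QbE; lra.
    have H6 : gamma * L * Qb t <= 1 / 32 * Qb t by rewrite ler_wpM2r//; lra.
    have H7 : gamma * L * (m * e t) <= gamma * L * Wb t.
      by rewrite ler_pM2l// WbE; lra.
    lra.
move=> t t0t; split => [p|i j]; rewrite -subr_lt0.
  exact: (h_neg t (inl p)).
exact: (h_neg t (inr (i, j))).
Qed.

End Confinement.
End SecondOrderSystem.

(** * Trigonometric bounds *)

Section Trigonometry.
Variable R : realType.
Implicit Types x beta : R.

Lemma sin_MVT (a b : R) : a < b ->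
  exists2 c, a < c < b & sin b - sin a = cos c * (b - a).
Proof.
move=> ab; have dsin x : x \in `]a, b[%R -> is_derive x 1 (@sin R) (cos x).
  by move=> _; exact: is_derive_sin.
have [c cab ->] := MVT ab dsin (continuous_subspaceT (@continuous_sin R)).
by exists c => //; move: cab; rewrite in_itv.
Qed.

(** The value 1 is the continuous extension; it keeps the lower bound sin beta / beta valid at 0. *)
Definition sinc x : R := if x == 0 then 1 else sin x / x.

Lemma sincK x : sinc x * x = sin x.
Proof. by rewrite /sinc; case: eqVneq => [->|x0]; rewrite ?sin0 ?mulr0// divfK. Qed.

Lemma sinc_norm x : sinc `|x| = sinc x.
Proof.
rewrite /sinc normr_eq0; case: eqVneq => // x0.
by case: (ger0P x) => // _; rewrite sinN invrN mulrNN.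
Qed.

Lemma sinc_le1 x : 0 <= x -> sinc x <= 1.
Proof.
rewrite /sinc le_eqVlt => /predU1P[<-|x0]; first by rewrite eqxx.
rewrite gt_eqF// ler_pdivrMr// mul1r.
have [c _] := sin_MVT x0; rewrite sin0 !subr0 => ->.
by rewrite -[leRHS]mul1r ler_pM2r// cos_le1.
Qed.

(* By the mean value theorem on [0, x] and [x, beta], the chord slopes of sin
   are values of cos, which decreases on [0, pi]. *)
Lemma sinc_decreasing x beta : 0 < x <= beta -> beta <= pi -> sinc beta <= sinc x.
Proof.
move=> /andP[x0]; rewrite le_eqVlt => /predU1P[-> //|xb bpi].
have b0 : 0 < beta by exact: lt_trans xb.
rewrite /sinc !gt_eqF// ler_pdivlMr// mulrAC ler_pdivrMr//.
have [c1 /andP[c10 c1x]] := sin_MVT x0; rewrite sin0 !subr0 => E1.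
have [c2 /andP[xc2 c2b] E2] := sin_MVT xb.
have cc : cos c2 <= cos c1.
  by apply: ltW; rewrite ltr_cos ?in_itv/=; try (apply/andP; split); lra.
have -> : sin beta = cos c2 * (beta - x) + sin x by rewrite -E2 subrK.
have := ler_wpM2r (ltW (mulr_gt0 x0 (_ : 0 < beta - x))) cc.
rewrite subr_gt0 => /(_ xb); rewrite E1; lra.
Qed.

Lemma sinc_bounds x beta : `|x| <= beta -> 0 < beta <= pi ->
  sin beta / beta <= sinc x <= 1.
Proof.
move=> xb /andP[b0 bpi]; rewrite -(sinc_norm x) sinc_le1// andbT.
have -> : sin beta / beta = sinc beta by rewrite /sinc gt_eqF.
have [->|x0] := eqVneq x 0; last by rewrite sinc_decreasing// normr_gt0 x0.
by rewrite normr0 {2}/sinc eqxx sinc_le1// ltW.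
Qed.

Lemma le_cos_norm x (z : R) : `|x| <= z -> z <= pi -> cos z <= cos x.
Proof.
move=> xz zpi; rewrite -(cos_norm x); move: xz; rewrite le_eqVlt => /predU1P[->//|xz].
apply: ltW; rewrite ltr_cos// in_itv/= ?zpi ?andbT ?(le_trans (normr_ge0 x) (ltW xz))//.
by rewrite normr_ge0 (le_trans (ltW xz)).
Qed.

Lemma le_sin_pihalf x (z : R) : 0 <= x -> x <= z -> z <= pi / 2 -> sin x <= sin z.
Proof.
move=> x0; rewrite le_eqVlt => /predU1P[->//|xz zpi].
have p0 := pi_ge0 R.
by apply: ltW; rewrite ltr_sin// in_itv/=; apply/andP; split; lra.
Qed.

End Trigonometry.

Section Spread.
Variables (R : realType) (N : nat).

Lemma spread_ge (z : 'I_N -> R) i j : z i - z j <= spread z.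
Proof.
by apply: lerB; [apply: (fmaxP z (i0 := i) _).2|apply: (fminP z (i0 := i) _).2].
Qed.

Lemma spread_attained (z : 'I_N -> R) (i0 : 'I_N) :
  exists i j, spread z = z i - z j.
Proof.
have [[i _ Ei] _] := @fmaxP _ _ predT z i0 isT.
by have [[j _ Ej] _] := @fminP _ _ predT z i0 isT; exists i, j; rewrite /spread Ei Ej.
Qed.

End Spread.

(** * The Kuramoto vector field *)

Section Kuramoto.
Variables (R : realType) (N : nat) (d Omega : 'I_N -> R) (K : R).
Variables (psi alpha : 'I_N -> 'I_N -> R).
Implicit Types (th : 'I_N -> R) (i j k : 'I_N).

Definition torque th i : R :=
  Omega i / d i
  + K / N%:R * \sum_(k < N) psi i k / d i * sin (th k - th i + alpha i k).

(** Expanding sin (a + alpha), the part cos a sin alpha survives at consensus and is treated as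
    bounded forcing. The part sin a cos alpha becomes linear in a through sin a = sinc a * a, giving
    [phase_weight]. *)
Definition phase_drift th i : R :=
  Omega i / d i
  + K / N%:R * \sum_(k < N) psi i k / d i * (cos (th k - th i) * sin (alpha i k)).

Definition phase_weight th i k : R :=
  K / N%:R * (psi i k / d i) * (sinc (th k - th i) * cos (alpha i k)).

Definition freq_weight th i k : R :=
  K / N%:R * (psi i k / d i) * cos (th k - th i + alpha i k).

Lemma torqueE th i :
  torque th i = phase_drift th i + coupling (phase_weight th) th i.
Proof.
rewrite /torque /phase_drift /coupling -addrA; congr (_ + _).
rewrite !mulr_sumr -big_split /=; apply: eq_bigr => k _.
by rewrite /phase_weight sinD -[sin (th k - th i)]sincK; ring.
Qed.

Lemma is_derive_torque (theta omega : 'I_N -> R -> R) (t : R) i :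
  (forall k, is_derive t 1 (theta k) (omega k t)) ->
  is_derive t 1 (fun s => torque (theta^~ s) i)
    (coupling (freq_weight (theta^~ t)) (omega^~ t) i).
Proof.
move=> dth.
have H k : is_derive t 1
    ((psi i k / d i) \*: (@sin R \o (theta k - theta i + cst (alpha i k))))
    ((psi i k / d i) * (cos (theta k t - theta i t + alpha i k)
       * (omega k t - omega i t))).
  have dk := dth k; have di := dth i; apply: is_deriveZ.
  suff G : is_derive t 1 (theta k - theta i + cst (alpha i k)) (omega k t - omega i t).
    exact: is_derive1_comp.
  by apply: is_derive_eq; rewrite addr0.
have -> : (fun s => torque (theta^~ s) i) = cst (Omega i / d i) + (K / N%:R) \*:
    \sum_(k < N) ((psi i k / d i) \*:
      (@sin R \o (theta k - theta i + cst (alpha i k)))).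
  by apply/funext => s; rewrite /torque /= fct_sumE.
have HS := is_derive_sum H.
apply: is_derive_eq; rewrite add0r /coupling /GRing.scale/= mulr_sumr.
by apply: eq_bigr => k _; rewrite /freq_weight; ring.
Qed.

Lemma alpha_le_bar i k : alpha i k <= alpha_bar alpha.
Proof.
exact: ((@fmaxP _ _ predT (fun p => alpha p.1 p.2) (i, k) isT).2 (i, k) isT).
Qed.

Lemma psi_le_u i k : i != k -> psi i k / d i <= psi_u d psi.
Proof.
move=> ik; exact: ((@fmaxP _ _ (fun p : 'I_N * 'I_N => p.1 != p.2)
  (fun p => psi p.1 p.2 / d p.1) (i, k) ik).2 (i, k) ik).
Qed.

Lemma connectivity_le i j : i != j ->
  connectivity d psi <= ergodicity (fun i k => psi i k / d i) i j.
Proof.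
move=> ij.
exact: ((@fminP _ _ (fun p : 'I_N * 'I_N => p.1 != p.2) _ (i, j) ij).2 (i, j) ij).
Qed.

Hypotheses (d_gt0 : forall i, 0 < d i) (K_gt0 : 0 < K).
Hypotheses (psi_ge0 : forall i j, 0 <= psi i j).
Hypotheses (alpha_itv : forall i j, 0 <= alpha i j < pi / 2).
Hypotheses (alpha_diag : forall i, alpha i i = 0).

Let L := K * psi_u d psi.
Let A := DOmega d Omega + 2 * K * psi_u d psi * sin (alpha_bar alpha).

(** The maximum is attained, so the strict bound pi / 2 survives; [i] witnesses that there are
    indices. *)
Lemma alpha_bar_itv i : 0 <= alpha_bar alpha < pi / 2.
Proof.
have [[[k l] _ /= E] _] := @fmaxP _ _ predT (fun p => alpha p.1 p.2) (i, i) isT.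
by rewrite /alpha_bar E.
Qed.

Let KN_ge0 : 0 <= K / N%:R.
Proof. by rewrite divr_ge0// ltW. Qed.

Let rate_ge0 i k : 0 <= psi i k / d i.
Proof. by rewrite divr_ge0// ltW. Qed.

Lemma psi_u_ge0 : 0 <= psi_u d psi.
Proof.
(* Without two distinct indices [fmax] takes its default value 0, which is also nonnegative. *)
rewrite /psi_u /fmax; case: pickP => [p _|//].
by case: [arg max_(_ > _ | _) _]%O => k l /=; exact: rate_ge0.
Qed.

Lemma cos_alpha_ge0 i k : 0 <= cos (alpha i k).
Proof.
apply: cos_ge0_pihalf; have /andP[a0 ap] := alpha_itv i k.
by apply/andP; split; have := pi_ge0 R; lra.
Qed.

Lemma scaled_weight_bound i k (c : R) : i != k -> 0 <= c <= 1 ->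
  0 <= K / N%:R * (psi i k / d i) * c <= L / N%:R.
Proof.
have w0 := mulr_ge0 KN_ge0 (rate_ge0 i k).
move=> ik /andP[c0 c1]; rewrite mulr_ge0//= -[leRHS]mulr1; apply: ler_pM => //.
have -> : L / N%:R = K / N%:R * psi_u d psi by rewrite /L mulrAC.
by rewrite (ler_wpM2l KN_ge0)// psi_le_u.
Qed.

Lemma weight_ergodicity w (c : R) : 0 <= c ->
  (forall i k, i != k -> K / N%:R * (psi i k / d i) * c <= w i k) ->
  forall i j, i != j -> K / N%:R * c * connectivity d psi <= ergodicity w i j.
Proof.
move=> c0 cw i j ij; have c0' : 0 <= K / N%:R * c by rewrite mulr_ge0.
apply: le_trans (ergodicity_le_scaled c0' ij _); last first.
  by move=> k l kl; rewrite mulrAC; exact: cw.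
by rewrite ler_wpM2l// connectivity_le.
Qed.

(** * Weights and forcing while the phases spread at most [beta] *)

Section PhaseRegime.
Variables (beta : R) (th : 'I_N -> R).
Hypotheses (beta_itv : 0 < beta <= pi) (th_beta : forall i j, th i - th j <= beta).

Let norm_beta i j : `|th i - th j| <= beta.
Proof. by rewrite ler_norml th_beta andbT lerNl opprB th_beta. Qed.

Let sin_beta_ge0 : 0 <= sin beta / beta.
Proof.
by case/andP: beta_itv => b0 bp; rewrite divr_ge0 ?sin_ge0_pi ?(ltW b0).
Qed.

Lemma phase_weight_bound i k : i != k -> 0 <= phase_weight th i k <= L / N%:R.
Proof.
move=> ik; apply: scaled_weight_bound => //.
have /andP[s0 s1] := sinc_bounds (norm_beta k i) beta_itv.
have s00 := le_trans sin_beta_ge0 s0.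
by rewrite mulr_ge0 ?cos_alpha_ge0//= mulr_ile1 ?cos_alpha_ge0 ?cos_le1.
Qed.

Lemma phase_ergodicity i j : i != j ->
  K / N%:R * (sin beta / beta * cos (alpha_bar alpha)) * connectivity d psi
  <= ergodicity (phase_weight th) i j.
Proof.
have /andP[a0 ap] := alpha_bar_itv i; have p0 := pi_ge0 R.
have ca : 0 <= cos (alpha_bar alpha) by apply: cos_ge0_pihalf; apply/andP; split; lra.
apply: weight_ergodicity; first by rewrite mulr_ge0.
move=> k l kl; rewrite /phase_weight (ler_wpM2l (mulr_ge0 KN_ge0 (rate_ge0 k l)))//.
have /andP[s0 _] := sinc_bounds (norm_beta l k) beta_itv.
apply: ler_pM => //; apply: le_cos_norm; last by lra.
by have /andP[? _] := alpha_itv k l; rewrite ger0_norm ?alpha_le_bar.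
Qed.

End PhaseRegime.

Lemma drift_sum_bound th i :
  `|K / N%:R * \sum_(k < N) psi i k / d i * (cos (th k - th i) * sin (alpha i k))|
  <= K * psi_u d psi * sin (alpha_bar alpha).
Proof.
have N0 : N%:R != 0 :> R.
  by rewrite pnatr_eq0 -lt0n; apply: leq_ltn_trans (ltn_ord i).
have /andP[a0 ap] := alpha_bar_itv i; have p0 := pi_ge0 R.
have sa : 0 <= sin (alpha_bar alpha) by apply: sin_ge0_pi; apply/andP; split; lra.
rewrite normrM ger0_norm//.
have -> : K * psi_u d psi * sin (alpha_bar alpha) =
    K / N%:R * \sum_(k < N) psi_u d psi * sin (alpha_bar alpha).
  by rewrite sumr_const card_ord -mulr_natl; field.
rewrite ler_wpM2l//; apply: le_trans (ler_norm_sum _ _ _) _.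
(* [psi_u] controls distinct pairs only; the diagonal term vanishes because [alpha i i = 0]. *)
apply: ler_sum => k _; have [->|ki] := eqVneq k i.
  by rewrite alpha_diag sin0 !mulr0 normr0 mulr_ge0// psi_u_ge0.
rewrite normrM (ger0_norm (rate_ge0 i k)); apply: ler_pM => //.
  by apply: psi_le_u; rewrite eq_sym.
have /andP[ai0 aip] := alpha_itv i k.
rewrite normrM -[leRHS]mul1r ler_pM ?cos_max// ger0_norm.
  by rewrite le_sin_pihalf ?alpha_le_bar// ltW.
by apply: sin_ge0_pi; apply/andP; split; lra.
Qed.

Lemma phase_drift_spread th i j : phase_drift th i - phase_drift th j <= A.
Proof.
have := spread_ge (fun i => Omega i / d i) i j; rewrite -/(DOmega d Omega).
have := drift_sum_bound th i; have := drift_sum_bound th j.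
by rewrite !ler_norml => /andP[? ?] /andP[? ?] ?; rewrite /phase_drift /A; lra.
Qed.

(** * Weights of the differentiated system for phases within [D] *)

Section FrequencyRegime.
Variables (D : R) (th : 'I_N -> R).
Hypotheses (D_alpha : D + alpha_bar alpha < pi / 2).
Hypotheses (th_D : forall i j, th i - th j <= D).

Let cos_ge i k : cos (D + alpha_bar alpha) <= cos (th k - th i + alpha i k).
Proof.
have /andP[a0 _] := alpha_itv i k; have aa := alpha_le_bar i k.
apply: le_cos_norm; last by have := pi_ge0 R; have := D_alpha; lra.
by rewrite ler_norml; apply/andP; split; have := th_D k i; have := th_D i k; lra.
Qed.

Let cosD_ge0 i : 0 <= cos (D + alpha_bar alpha).
Proof.
have := th_D i i; rewrite subrr => D0; have /andP[a0 _] := alpha_bar_itv i.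
apply: cos_ge0_pihalf; have := D_alpha; have := pi_ge0 R => *.
by apply/andP; split; lra.
Qed.

Lemma freq_weight_bound i k : i != k -> 0 <= freq_weight th i k <= L / N%:R.
Proof.
move=> ik; apply: scaled_weight_bound => //.
by rewrite (le_trans _ (cos_ge i k)) ?cosD_ge0 ?cos_le1.
Qed.

Lemma freq_ergodicity i j : i != j ->
  K / N%:R * cos (D + alpha_bar alpha) * connectivity d psi
  <= ergodicity (freq_weight th) i j.
Proof.
apply: weight_ergodicity; first exact: cosD_ge0.
by move=> k l kl; rewrite /freq_weight (ler_wpM2l (mulr_ge0 KN_ge0 (rate_ge0 k l))).
Qed.

End FrequencyRegime.
End Kuramoto.

(** * Both consensus systems along a Kuramoto solution *)

Section Synchronization.
Variables (R : realType) (N : nat) (d Omega : 'I_N -> R) (gamma K : R).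
Variables (psi alpha : 'I_N -> 'I_N -> R).
Hypotheses (d_gt0 : forall i, 0 < d i) (K_gt0 : 0 < K) (gamma_gt0 : 0 < gamma).
Hypotheses (psi_ge0 : forall i j, 0 <= psi i j).
Hypotheses (alpha_itv : forall i j, 0 <= alpha i j < pi / 2).
Hypotheses (alpha_diag : forall i, alpha i i = 0).

Let L := K * psi_u d psi.
Let A := DOmega d Omega + 2 * K * psi_u d psi * sin (alpha_bar alpha).
Hypothesis L_gt0 : 0 < L.

Variables theta omega : 'I_N -> R -> R.
Hypothesis sol : kuramoto_solution d Omega gamma K psi alpha theta omega.

Let F t i := torque d Omega K psi alpha (theta^~ t) i.

(** The equation solved for the second derivative. As an explicit function of [theta] and [omega] it
    can be differentiated again, although a solution is only assumed twice differentiable. *)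
Definition acceleration (i : 'I_N) (t : R) : R :=
  (torque d Omega K psi alpha (theta^~ t) i - omega i t) / gamma.

Lemma phase_derivative i (t : R) : 0 < t -> is_derive t 1 (theta i) (omega i t).
Proof. by move=> t0; apply: time_derivative_is_derive t0 (sol i (ltW t0)).1. Qed.

Lemma velocity_derivative i (t : R) : 0 < t ->
  is_derive t 1 (omega i) (acceleration i t).
Proof.
move=> t0; have [_ [a da E]] := sol i (ltW t0).
have -> : acceleration i t = a.
  by rewrite /acceleration /torque -E addrK mulrC mulKf// gt_eqF.
exact: time_derivative_is_derive t0 da.
Qed.

Lemma phase_right_continuous i : theta i s @[s --> 0^'+] --> theta i 0.
Proof. exact: time_derivative_right_continuous (sol i (lexx 0)).1. Qed.

Lemma velocity_right_continuous i : omega i s @[s --> 0^'+] --> omega i 0.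
Proof.
by have [_ [a da _]] := sol i (lexx 0); exact: time_derivative_right_continuous da.
Qed.

(** The summand 0 is the forcing [b] of the differentiated system, written out to match the
    second-order form. *)
Lemma acceleration_derivative i (t : R) : 0 < t ->
  is_derive t 1 (acceleration i)
    ((0 + coupling (freq_weight d K psi alpha (theta^~ t)) (omega^~ t) i
      - acceleration i t) / gamma).
Proof.
move=> t0; have dF := @is_derive_torque _ _ d Omega K psi alpha theta omega t i
  (fun k => phase_derivative k t0).
have dw := velocity_derivative i t0.
suff : is_derive t 1
    (gamma^-1 \*: ((fun s => torque d Omega K psi alpha (theta^~ s) i) - omega i))
    ((0 + coupling (freq_weight d K psi alpha (theta^~ t)) (omega^~ t) i
      - acceleration i t) / gamma).
  by congr is_derive; apply/funext => s; rewrite /acceleration mulrC.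
by apply: is_derive_eq; rewrite add0r /GRing.scale/= mulrC.
Qed.

Section Phase.
Variables (beta D m q : R).
Let kappa := K / N%:R * (sin beta / beta * cos (alpha_bar alpha)) * connectivity d psi.
Let Wb := lyapunov_barrier kappa D m.
Let Qb := velocity_barrier gamma L kappa A D m q.

Lemma phase_confinement :
  0 < beta <= pi -> 0 <= A -> 0 <= m -> 0 <= q ->
  kappa <= L -> 32 * gamma * L ^+ 2 < kappa -> 8 * A < kappa * D ->
  Wb 0 + Qb 0 <= beta ->
  (forall p, lyapunov theta omega gamma L p 0 < Wb 0) ->
  (forall i j, gamma * (omega i 0 - omega j 0) < Qb 0) ->
  forall t, 0 <= t ->
    (forall i j, theta i t - theta j t <= Wb t + Qb t) /\
    (forall i j, gamma * (omega i t - omega j t) < Qb t).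
Proof.
move=> bpi A0 m0 q0 kL Lk Ak WQ W0 Q0 t t0.
have regime s : 0 < s -> (forall i j, theta i s - theta j s <= beta) ->
    [/\ forall i j, phase_drift d Omega K psi alpha (theta^~ s) i
                    - phase_drift d Omega K psi alpha (theta^~ s) j <= A,
        forall i j, i != j ->
          0 <= phase_weight d K psi alpha (theta^~ s) i j <= L / N%:R &
        forall i j, i != j ->
          kappa <= ergodicity (phase_weight d K psi alpha (theta^~ s)) i j].
  move=> s0 th; split=> i j.
  - exact: phase_drift_spread.
  - exact: (phase_weight_bound d_gt0 K_gt0 psi_ge0 alpha_itv bpi th).
  - exact: (phase_ergodicity d_gt0 K_gt0 psi_ge0 alpha_itv bpi th).
have om_der i (s : R) : 0 < s -> is_derive s 1 (omega i)
    ((phase_drift d Omega K psi alpha (theta^~ s) i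
      + coupling (phase_weight d K psi alpha (theta^~ s)) (theta^~ s) i
      - omega i s) / gamma).
  by rewrite -torqueE; exact: velocity_derivative.
have [Wt Qt] := confinement gamma_gt0 L_gt0 kL Lk phase_derivative om_der
  phase_right_continuous velocity_right_continuous A0 m0 q0 Ak regime WQ W0 Q0 t0.
split=> // i j.
apply: (@spread_position _ _ (theta^~ t) (omega^~ t) gamma) => k l; apply: ltW.
  by have := Wt (k, l, k, k); rewrite /lyapunov/= subrr !mulr0 addr0.
exact: Qt.
Qed.

End Phase.

Section Frequency.
Variables (D T F0 G0 : R).
Let kappa := K / N%:R * cos (D + alpha_bar alpha) * connectivity d psi.

(** At time T, omega + gamma omega' is the torque, of spread at most [F0], and gamma omega' has
    spread at most [F0 + G0]. The 1 makes the bound on the functional strict; the exponential shifts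
    the time origin from T to 0. *)
Definition frequency_constant : R :=
  ((1 + 4 * gamma * L) * F0 + 4 * gamma * L * G0 + 1) * expR (kappa / 4 * T).

Lemma frequency_constant_gt0 : 0 <= F0 -> 0 <= G0 -> 0 < frequency_constant.
Proof.
move=> F00 G00; have gL : 0 <= 4 * gamma * L.
  by apply: mulr_ge0 (ltW L_gt0); apply: mulr_ge0 => //; exact: ltW.
by rewrite mulr_gt0 ?expR_gt0// ltr_wpDl// addr_ge0// mulr_ge0// addr_ge0.
Qed.

Lemma frequency_decay :
  0 < T -> D + alpha_bar alpha < pi / 2 -> 0 <= F0 -> 0 <= G0 ->
  kappa <= L -> 32 * gamma * L ^+ 2 < kappa ->
  (forall t, T <= t -> forall i j, theta i t - theta j t <= D) ->
  (forall i j, F T i - F T j <= F0) ->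
  (forall i j, omega i T - omega j T <= G0) ->
  forall t, T <= t -> forall i j,
    omega i t - omega j t <=
    frequency_constant * (1 + (4 * gamma * L)^-1) * expR (- (kappa / 4) * t).
Proof.
move=> T0 Da F00 G00 kL Lk thD FT wT t Tt i j.
have gL : 0 < 4 * gamma * L by apply: mulr_gt0 => //; exact: mulr_gt0.
have vE k s : omega k s + gamma * acceleration k s = F s k.
  by rewrite /acceleration mulrC divfK ?gt_eqF// addrC subrK.
have aE k l s : gamma * (acceleration k s - acceleration l s) =
    F s k - F s l - (omega k s - omega l s).
  by rewrite -!vE; ring.
have B0 := frequency_constant_gt0 F00 G00.
have VT p : lyapunov omega acceleration gamma L p T <
    frequency_constant * expR (- (kappa / 4) * T).
  rewrite /frequency_constant -mulrA -expRD mulNr subrr expR0 mulr1 /lyapunov !vE aE.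
  have H1 := FT p.1.1.1 p.1.1.2; have H2 := FT p.1.2 p.2; have H3 := wT p.2 p.1.2.
  have H4 : F T p.1.2 - F T p.2 - (omega p.1.2 T - omega p.2 T) <= F0 + G0 by lra.
  have := ler_wpM2l (ltW gL) H4; lra.
have dw k (s : R) : T < s -> is_derive s 1 (omega k) (acceleration k s).
  by move=> Ts; apply: velocity_derivative; exact: lt_trans Ts.
have da k (s : R) : T < s -> is_derive s 1 (acceleration k)
    ((0 + coupling (freq_weight d K psi alpha (theta^~ s)) (omega^~ s) k
      - acceleration k s) / gamma).
  by move=> Ts; apply: acceleration_derivative; exact: lt_trans Ts.
have V := @homogeneous_decay _ _ omega acceleration
  (fun s => freq_weight d K psi alpha (theta^~ s)) (fun _ _ => 0) gamma L kappa T
  gamma_gt0 L_gt0 kL Lk dw da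
  (* As [T > 0], continuity at T comes from two-sided derivatives. *)
  (fun k => is_derive_right_continuous (velocity_derivative k T0))
  (fun k => is_derive_right_continuous (acceleration_derivative k T0))
  frequency_constant.
have {}V p : lyapunov omega acceleration gamma L p t <
    frequency_constant * expR (- (kappa / 4) * t).
  apply: V => // s Ts k l.
  - exact: (freq_weight_bound d_gt0 K_gt0 psi_ge0 alpha_itv Da (thD s (ltW Ts))).
  - exact: (freq_ergodicity d_gt0 K_gt0 psi_ge0 alpha_itv Da (thD s (ltW Ts))).
(* Degenerate quadruples isolate the two parts of the functional: the torque difference is below E
   and the gamma omega' difference below E / (4 gamma L). The velocity difference is recovered from
   these two. *)
have := V (i, j, i, i); rewrite /lyapunov /= subrr !mulr0 addr0 !vE => H1.
have := V (i, i, j, i); rewrite /lyapunov /= subrr add0r aE -ltr_pdivlMl// => H2.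
move: H1 H2; set E := _ * expR _ => H1 H2.
rewrite -mulrA [X in _ * X]mulrC mulrA -/E; lra.
Qed.

End Frequency.
End Synchronization.

(** * Choice of the barrier level and of the entry time *)

(** Here [g], [a], [v], [d0] stand for gamma L, gamma A, gamma D_omega(0), D_theta(0). [M] is the
    initial height of the Lyapunov barrier: above the initial functional, yet with both barriers
    summing to at most [beta]. *)
Lemma barrier_level (R : realFieldType) (D beta d0 v a g : R) :
  0 < D < beta -> 0 <= d0 -> 0 <= v -> 0 <= a -> 256 * a < D ->
  0 < g -> 32 * g < 1 -> 2 * a + (1 + 4 * g) * d0 + 3 * v < beta ->
  exists M, [/\ D / 3 < M, d0 + v + 4 * g * v < M
              & (1 + 4 * g) * M + 2 * a + v <= beta].
Proof.
move=> /andP[D0 Db] d00 v0 a0 aD g0 g1 init.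
pose M0 := Num.max (d0 + 9 / 8 * v) (D / 3).
have gd : 0 <= g * d0 by rewrite mulr_ge0// ltW.
have gv : 4 * g * v <= 1 / 8 * v by rewrite ler_wpM2r//; lra.
have gD : 4 * g * D <= 1 / 8 * D by rewrite ler_wpM2r//; lra.
have S_lt : (1 + 4 * g) * M0 + 2 * a + v < beta.
  by rewrite /M0; case: (lerP (d0 + 9 / 8 * v) (D / 3)) => _; lra.
set S := _ + v in S_lt.
have M1 : d0 + 9 / 8 * v <= M0 by rewrite le_max lexx.
have M2 : D / 3 <= M0 by rewrite le_max lexx orbT.
(* Half the slack makes the lower bounds strict and costs (1 + 4 g) / 2 <= 9/16 of it in the upper
   bound. *)
exists (M0 + (beta - S) / 2); split; [lra|lra|].
have H : 4 * g * (beta - S) <= 1 / 8 * (beta - S) by rewrite ler_wpM2r//; lra.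
by move: H; rewrite /S in S_lt *; lra.
Qed.

(* e^(-X) <= 1/X, so at time T = 2 X / kappa the transient parts of the two
   barriers add up to at most D / 2. *)
Lemma barriers_eventually (R : realType) (kappa gamma L A D m q : R) :
  0 < kappa -> 0 < gamma -> 0 < L -> 32 * (gamma * L) < 1 -> 0 < D ->
  256 * (gamma * A) < D -> 0 < m -> 0 <= q ->
  exists2 T, 0 < T &
    lyapunov_barrier kappa D m T + velocity_barrier gamma L kappa A D m q T <= D.
Proof.
move=> k0 g0 L0 gL D0 gA m0 q0.
pose X := 2 * (9 / 8 * m + q) / D.
have X0 : 0 < X by rewrite divr_gt0//; lra.
exists (2 * X / kappa); first by rewrite divr_gt0// mulr_gt0.
rewrite /velocity_barrier /lyapunov_barrier.
have -> : - (kappa / 2) * (2 * X / kappa) = - X by field; rewrite gt_eqF.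
have e0 := expR_gt0 (- X); set e := expR (- X) in e0 *.
have Xe : X * e < 1.
  have := expR_ge1Dx X; rewrite -(ler_pM2r e0) /e -expRD subrr expR0 -/e; lra.
have {}Xe : 9 / 8 * (m * e) + q * e < D / 2.
  have -> : 9 / 8 * (m * e) + q * e = D / 2 * (X * e).
    by rewrite /X; field; rewrite gt_eqF.
  by rewrite -[ltRHS]mulr1 ltr_pM2l// divr_gt0.
have me : 0 < m * e by rewrite mulr_gt0.
have gm : 4 * (gamma * L) * (m * e) <= 1 / 8 * (m * e) by rewrite ler_wpM2r//; lra.
have gD : 4 * (gamma * L) * D <= 1 / 8 * D by rewrite ler_wpM2r//; lra.
lra.
Qed.

(** * From the parameter conditions to exponential synchronization *)

Theorem theorem2p1 (R : realType) (N : nat) (N_ge2 : (2 <= N)%N)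
    (d m Omega : 'I_N -> R) (gamma K : R) (psi alpha : 'I_N -> 'I_N -> R)
    (theta0 omega0 : 'I_N -> R) (beta Dinf : R)
    (d_gt0 : forall i, 0 < d i)
    (m_gt0 : forall i, 0 < m i)
    (gammaE : forall i, m i / d i = gamma)
    (K_gt0 : 0 < K)
    (psi_ge0 : forall i j, 0 <= psi i j)
    (alpha_itv : forall i j, 0 <= alpha i j < pi / 2)
    (alpha_diag : forall i, alpha i i = 0)
    (conn_gt0 : 0 < connectivity d psi)
    (beta_itv : 0 < beta < pi)
    (Dinf_itv : 0 < Dinf < Num.min beta (pi / 2))
    (init_small :
       2 * gamma * (DOmega d Omega
                    + 2 * K * psi_u d psi * sin (alpha_bar alpha))
       + (1 + 4 * gamma * K * psi_u d psi) * spread theta0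
       + 3 * gamma * spread omega0 < beta)
    (Dinf_alpha : Dinf + alpha_bar alpha < pi / 2)
    (gammaK_small :
       gamma * K <
       Num.min (connectivity d psi * cos (alpha_bar alpha) * sin beta
                / (32 * N%:R * psi_u d psi ^+ 2 * beta))
      (Num.min (N%:R * beta
                / (connectivity d psi * cos (alpha_bar alpha) * sin beta))
      (Num.min (connectivity d psi * cos (Dinf + alpha_bar alpha)
                / (32 * N%:R * psi_u d psi ^+ 2))
               (2 * N%:R
                / (connectivity d psi * cos (Dinf + alpha_bar alpha))))))
    (K_large :
       Num.max (8 * N%:R * beta
                * (DOmega d Omega
                   + 2 * K * psi_u d psi * sin (alpha_bar alpha))
                / (Dinf * connectivity d psi * cos (alpha_bar alpha)
                   * sin beta))
               (8 * N%:R * mu d Omega K psi alpha beta Dinf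
                / (connectivity d psi * cos (Dinf + alpha_bar alpha)))
       < K) :
  exists C Lambda : R,
    [/\ 0 < C, 0 < Lambda &
        forall theta omega : 'I_N -> R -> R,
          kuramoto_solution d Omega gamma K psi alpha theta omega ->
          (forall i, theta i 0 = theta0 i) ->
          (forall i, omega i 0 = omega0 i) ->
          forall t : R, 0 <= t ->
            spread (fun i => omega i t) <= C * expR (- Lambda * t)].
Proof.
have i0 : 'I_N by exact: (Ordinal N_ge2).
have N0 : 0 < N%:R :> R by rewrite ltr0n (ltn_trans _ N_ge2).
have gamma_gt0 : 0 < gamma by rewrite -(gammaE i0) divr_gt0.
have /andP[b0 bpi] := beta_itv.
have /andP[D0 Db] := Dinf_itv; move: Db; rewrite lt_min => /andP[Db Dpi].
have /andP[a0 api] := alpha_bar_itv alpha_itv i0.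
have p0 := pi_gt0 R.
have bpi' : 0 < beta <= pi by rewrite b0 ltW.
have sb0 : 0 < sin beta by exact: sin_gt0_pi.
have ca0 : 0 < cos (alpha_bar alpha).
  by apply: cos_gt0_pihalf; apply/andP; split; lra.
have cD0 : 0 < cos (Dinf + alpha_bar alpha).
  by apply: cos_gt0_pihalf; apply/andP; split; lra.
have sa0 : 0 <= sin (alpha_bar alpha).
  by apply: sin_ge0_pi; apply/andP; split; lra.
(* This gives both [psi_u > 0], from positive connectivity, and the bounds of [kappa] and [kappa']
   by [L]. *)
have conn_le : connectivity d psi <= N%:R * psi_u d psi.
  have ij : Ordinal (ltnW N_ge2) != Ordinal N_ge2 :> 'I_N by [].
  apply: le_trans (connectivity_le d psi ij) _.
  by apply: ergodicity_le ij _ => k l; exact: psi_le_u.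
have u0 : 0 < psi_u d psi by rewrite -(pmulr_rgt0 _ N0); exact: lt_le_trans conn_le.
pose L := K * psi_u d psi.
pose A := DOmega d Omega + 2 * K * psi_u d psi * sin (alpha_bar alpha).
have L0 : 0 < L by exact: mulr_gt0.
have A0 : 0 <= A.
  apply: addr_ge0; last by rewrite !mulr_ge0// ltW.
  by have := spread_ge (fun i => Omega i / d i) i0 i0; rewrite subrr.
have rate_leL c : 0 <= c <= 1 -> K / N%:R * c * connectivity d psi <= L.
  move=> /andP[c0 c1]; apply: (@le_trans _ _ (K / N%:R * c * (N%:R * psi_u d psi))).
    by rewrite ler_wpM2l// !mulr_ge0// ?invr_ge0 ltW.
  have -> : K / N%:R * c * (N%:R * psi_u d psi) = L * c.
    by rewrite /L; field; rewrite gt_eqF.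
  by rewrite -[leRHS]mulr1 ler_pM2l.
pose kappa := K / N%:R * (sin beta / beta * cos (alpha_bar alpha)) * connectivity d psi.
pose kappa' := K / N%:R * cos (Dinf + alpha_bar alpha) * connectivity d psi.
have kappa0 : 0 < kappa by rewrite !mulr_gt0// invr_gt0.
have kL : kappa <= L.
  apply: rate_leL; have := sinc_le1 (ltW b0); rewrite /sinc gt_eqF// => s1.
  have s0 : 0 <= sin beta / beta by rewrite divr_ge0// ltW.
  have c0 := ltW ca0; rewrite mulr_ge0//=; apply: mulr_ile1 => //; exact: cos_le1.
have kL' : kappa' <= L by apply: rate_leL; rewrite cos_le1 ltW.
move: gammaK_small; rewrite !lt_min => /and4P[gK1 _ gK2 _].
move: K_large; rewrite gt_max => /andP[K1 _].
(* Once denominators are cleared, multiplying the hypotheses by K / (N beta), K / N and 1 / (N beta)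
   turns them into [Lk], [Lk'] and [Ak]. *)
have Lk : 32 * gamma * L ^+ 2 < kappa.
  move: gK1; rewrite ltr_pdivlMr ?mulr_gt0 ?exprn_gt0//.
  rewrite -(ltr_pM2r (divr_gt0 K_gt0 (mulr_gt0 N0 b0))).
  by congr (_ < _); rewrite /L /kappa; field; rewrite !gt_eqF.
have Lk' : 32 * gamma * L ^+ 2 < kappa'.
  move: gK2; rewrite ltr_pdivlMr ?mulr_gt0 ?exprn_gt0// -(ltr_pM2r (divr_gt0 K_gt0 N0)).
  by congr (_ < _); rewrite /L /kappa'; field; rewrite !gt_eqF.
have Ak : 8 * A < kappa * Dinf.
  move: K1; rewrite ltr_pdivrMr ?mulr_gt0//.
  rewrite -(ltr_pM2r (divr_gt0 ltr01 (mulr_gt0 N0 b0))).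
  by congr (_ < _); rewrite /A /kappa; field; rewrite !gt_eqF.
have gL := gammaL_lt L0 kL Lk.
have gL0 : 0 < gamma * L by exact: mulr_gt0.
have gA0 : 0 <= gamma * A by rewrite mulr_ge0// ltW.
(* Chain 8 gamma A < gamma kappa Dinf <= gamma L Dinf <= Dinf / 32. *)
have gA : 256 * (gamma * A) < Dinf.
  have H1 : gamma * (8 * A) < gamma * (kappa * Dinf) by rewrite ltr_pM2l.
  have H2 : gamma * (kappa * Dinf) <= gamma * L * Dinf.
    by rewrite mulrA ler_wpM2r// ?ler_pM2l// ltW.
  have H3 : 32 * (gamma * L) * Dinf <= Dinf by rewrite -[leRHS]mul1r ler_wpM2r// ltW.
  lra.
have th00 : 0 <= spread theta0 by have := spread_ge theta0 i0 i0; rewrite subrr.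
have om00 : 0 <= spread omega0 by have := spread_ge omega0 i0 i0; rewrite subrr.
have v0 : 0 <= gamma * spread omega0 by rewrite mulr_ge0// ltW.
have DDb : 0 < Dinf < beta by rewrite D0.
have init : 2 * (gamma * A) + (1 + 4 * (gamma * L)) * spread theta0
    + 3 * (gamma * spread omega0) < beta.
  by move: init_small; rewrite -/A /L; lra.
have [M [DM WM MQ]] := barrier_level DDb th00 v0 gA0 gA gL0 gL init.
(* Chosen so that the Lyapunov barrier starts exactly at [M]. *)
pose m' := M - Dinf / 3; pose q := gamma * spread omega0.
have m0 : 0 < m' by rewrite subr_gt0.
have [T T0 TD] := barriers_eventually kappa0 gamma_gt0 L0 gL D0 gA m0 v0.
(* [F0] bounds the torque spread for phases within [beta]; [G0] bounds the velocity spread because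
   the velocity barrier never exceeds [beta]. Neither depends on the solution, so the constants can
   be fixed before it is introduced. *)
pose F0 := A + 2 * L * beta.
have F00 : 0 <= F0 by rewrite addr_ge0// !mulr_ge0// ltW.
pose G0 := beta / gamma.
have G00 : 0 < G0 by exact: divr_gt0.
pose C1 := frequency_constant d gamma K psi alpha Dinf T F0 G0
           * (1 + (4 * gamma * L)^-1).
have kappa'0 : 0 < kappa' by rewrite !mulr_gt0// invr_gt0.
have C10 : 0 < C1.
  apply: mulr_gt0; first exact: frequency_constant_gt0 (ltW G00).
  by rewrite addr_gt0// invr_gt0 !mulr_gt0.
(* The first summand covers times before T, where expR (kappa' / 4 * (T - t)) >= 1; the second
   covers times from T on. *)
exists (G0 * expR (kappa' / 4 * T) + C1), (kappa' / 4); split.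
- by rewrite addr_gt0// mulr_gt0// expR_gt0.
- by rewrite divr_gt0.
move=> theta omega sol theta_0 omega_0 t t0.
have W0 : lyapunov_barrier kappa Dinf m' 0 = M.
  by rewrite /lyapunov_barrier mulr0 expR0 mulr1 /m' addrC subrK.
have Q0 : velocity_barrier gamma L kappa A Dinf m' q 0 =
    2 * (gamma * A) + 4 * (gamma * L) * M + q.
  by rewrite /velocity_barrier W0 mulr0 expR0 mulr1 !mulrA.
have WQ0 : lyapunov_barrier kappa Dinf m' 0
    + velocity_barrier gamma L kappa A Dinf m' q 0 <= beta.
  by rewrite W0 Q0; move: MQ; rewrite -/q; lra.
have M0 : 0 < M by lra.
have om_0 i j : gamma * (omega i 0 - omega j 0) <= q.
  by rewrite ler_pM2l// !omega_0 spread_ge.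
have [th_t om_t] : (forall s, 0 <= s -> forall i j, theta i s - theta j s <=
      lyapunov_barrier kappa Dinf m' s
      + velocity_barrier gamma L kappa A Dinf m' q s) /\
    (forall s, 0 <= s -> forall i j, gamma * (omega i s - omega j s) <
      velocity_barrier gamma L kappa A Dinf m' q s).
  have V0 p : lyapunov theta omega gamma L p 0 < lyapunov_barrier kappa Dinf m' 0.
    rewrite W0 /lyapunov !theta_0.
    have H1 := om_0 p.1.1.1 p.1.1.2; have H3 := spread_ge theta0 p.1.1.1 p.1.1.2.
    have := ler_wpM2l (ltW gL0) (om_0 p.1.2 p.2).
    move: WM; rewrite -/q; lra.
  have U0 i j : gamma * (omega i 0 - omega j 0) <
      velocity_barrier gamma L kappa A Dinf m' q 0.
    by rewrite Q0; apply: le_lt_trans (om_0 i j) _; have := mulr_gt0 gL0 M0; lra.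
  have conf s := @phase_confinement _ _ d Omega gamma K psi alpha d_gt0 K_gt0
    gamma_gt0 psi_ge0 alpha_itv alpha_diag L0 theta omega sol beta Dinf m' q
    bpi' A0 (ltW m0) v0 kL Lk Ak WQ0 V0 U0 s.
  by split => s s0; have [] := conf s s0.
have sum_le s r : s <= r ->
    lyapunov_barrier kappa Dinf m' r + velocity_barrier gamma L kappa A Dinf m' q r <=
    lyapunov_barrier kappa Dinf m' s + velocity_barrier gamma L kappa A Dinf m' q s.
  by apply: barriers_decrease => //; exact: ltW.
have th_beta s : 0 <= s -> forall i j, theta i s - theta j s <= beta.
  by move=> s0 i j; apply: le_trans (th_t s s0 i j) (le_trans (sum_le 0 s s0) WQ0).
have om_beta s : 0 <= s -> forall i j, omega i s - omega j s <= G0.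
  move=> s0 i j; rewrite ler_pdivlMr// mulrC; apply: ltW.
  apply: lt_le_trans (om_t s s0 i j) (le_trans _ (le_trans (sum_le 0 s s0) WQ0)).
  by rewrite lerDr addr_ge0// ?mulr_ge0 ?expR_ge0// ?divr_ge0// ltW.
have [i [j ->]] := spread_attained (fun i => omega i t) i0.
have e0 := expR_gt0 (- (kappa' / 4) * t).
rewrite mulrDl; have [tT|Tt] := ltP t T.
  apply: (@le_trans _ _ (G0 * expR (kappa' / 4 * T) * expR (- (kappa' / 4) * t))).
    apply: le_trans (om_beta t t0 i j) _.
    rewrite -mulrA -expRD -[leLHS]mulr1 ler_pM2l// -expR0 ler_expR mulNr -mulrBr.
    by rewrite mulr_ge0 ?subr_ge0// ?ltW// divr_gt0.
  by rewrite lerDl mulr_ge0// ltW.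
apply: (@le_trans _ _ (C1 * expR (- (kappa' / 4) * t))); last first.
  by rewrite lerDr; apply: mulr_ge0 (ltW e0); apply: mulr_ge0 (expR_ge0 _); exact: ltW.
apply: (@frequency_decay _ _ d Omega gamma K psi alpha d_gt0 K_gt0 gamma_gt0
  psi_ge0 alpha_itv L0 theta omega sol Dinf T F0 G0) => //.
- exact: ltW.
- move=> s Ts k l; have s0 : 0 <= s by exact: le_trans (ltW T0) Ts.
  exact: le_trans (th_t s s0 k l) (le_trans (sum_le T s Ts) TD).
- move=> k l; have thT := th_beta T (ltW T0).
  rewrite !torqueE; apply: (@force_spread _ _ _ _ _ L A L0 _ _ beta k l thT).
  + by move=> *; exact: phase_drift_spread.
  + exact: (phase_weight_bound d_gt0 K_gt0 psi_ge0 alpha_itv bpi' thT).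
- exact: om_beta (ltW T0).
Qed.
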